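(* Let $R$ and $S$ be arbitrary rings and let ${}_RC_S$ be a semidualizing $(R,S)$-bimodule. If the Bass class $\mathcal{B}_C(R)$ is enveloping in $\operatorname{Mod} R$, then the Auslander class $\mathcal{A}_C(S)$ is enveloping in $\operatorname{Mod} S$.
   Context: All rings are associative with identity. For a ring $T$, $\operatorname{Mod} T$ is the category of left $T$-modules, and $\operatorname{Mod} T^{op}$ is identified with the category of right $T$-modules. All subcategories are full and closed under isomorphisms. Semidualizing: an $(R,S)$-bimodule ${}_RC_S$ is semidualizing if (a1) ${}_RC$ has a projective resolution by finitely generated projective left $R$-modules; (a2) $C_S$ has a projective resolution by finitely generated projective right $S$-modules; (b1) the homothety map $R\to\operatorname{Hom}_{S^{op}}(C,C)$ is an isomorphism; (b2) the homothety map $S\to\operatorname{Hom}_R(C,C)$ is an isomorphism; (c1) $\operatorname{Ext}_R^{i}(C,C)=0$ for all $i\ge1$; (c2) $\operatorname{Ext}_{S^{op}}^{i}(C,C)=0$ for all $i\geq 1$. Auslander class $\mathcal{A}_C(S)$: all $N\in\operatorname{Mod} S$ such that $\operatorname{Tor}^S_i(C,N)=0$ for all $i\ge1$; $\operatorname{Ext}^i_R(C,C\otimes_SN)=0$ for all $i\ge1$; and the map $\mu_N:N\to\operatorname{Hom}_R(C,C\otimes_SN)$, $\mu_N(x)(c)=c\otimes x$, is an isomorphism. Bass class $\mathcal{B}_C(R)$: all $M\in\operatorname{Mod} R$ such that $\operatorname{Ext}_R^i(C,M)=0$ for all $i\ge1$; $\operatorname{Tor}^S_i(C,\operatorname{Hom}_R(C,M))=0$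 for all $i\ge1$; and the map $\theta_M:C\otimes_S\operatorname{Hom}_R(C,M)\to M$, $\theta_M(c\otimes f)=f(c)$, is an isomorphism. Envelopes: let $\mathscr{X}\subseteq\operatorname{Mod} T$. A homomorphism $f:Y\to X$ with $X\in\mathscr{X}$ is an $\mathscr{X}$-preenvelope of $Y$ if $\operatorname{Hom}_T(f,X')$ is surjective for every $X'\in\mathscr{X}$; it is an $\mathscr{X}$-envelope if in addition it is left minimal, i.e. every endomorphism $h$ of $X$ with $f=hf$ is an automorphism. $\mathscr{X}$ is enveloping in $\operatorname{Mod} T$ if every $T$-module has an $\mathscr{X}$-envelope. *)

(* Defs.v *)
From HB Require Import structures.
From mathcomp Require Import all_boot all_algebra.
From mathcomp Require Import boolp functions.

Set Implicit Arguments.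
Unset Strict Implicit.
Unset Printing Implicit Defensive.

Import GRing.Theory.
Local Open Scope ring_scope.
Local Open Scope quotient_scope.

(* Rings are associative and unital but possibly noncommutative or trivial
   ([pzRingType]). Left T-modules are [lmodType T]; right T-modules are left
   modules over the converse ring, [lmodType T^c]. Every type carries a
   [choiceType] structure by classical choice, so [lmodType T] is no smaller
   than the class of all modules. *)

Definition hom (R : pzRingType) (U V : lmodType R) : Type := {linear U -> V}.

Section Hom.
Context (R : pzRingType) (U V : lmodType R).
Implicit Types f g h : hom U V.

Definition hom_fun f : U -> V := (f : {linear U -> V}).
Coercion hom_fun : hom >-> Funclass.

HB.instance Definition _ f := GRing.Linear.on (hom_fun f).

Lemma hom_ext f g : (forall x, f x = g x) -> f = g.
Proof.
case: f => f [[Df0] [Sf]]; case: g => g [[Dg0] [Sg]] /= fg.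
have {}fg : f = g by apply: funext.
case: _ / fg in Dg0 Sg *.
by rewrite (Prop_irrelevance Df0 Dg0) (Prop_irrelevance Sf Sg).
Qed.

HB.instance Definition _ := gen_eqMixin (hom U V).
HB.instance Definition _ := gen_choiceMixin (hom U V).

Definition hom_zero : hom U V := (\0 : U -> V) : {linear U -> V}.
Definition hom_opp f : hom U V := (\- (f : U -> V)) : {linear U -> V}.
Definition hom_add f g : hom U V := ((f : U -> V) \+ g) : {linear U -> V}.

Fact hom_addA : associative hom_add.
Proof. by move=> f g h; apply: hom_ext => x /=; exact: addrA. Qed.
Fact hom_addC : commutative hom_add.
Proof. by move=> f g; apply: hom_ext => x /=; exact: addrC. Qed.
Fact hom_add0 : left_id hom_zero hom_add.
Proof. by move=> f; apply: hom_ext => x /=; exact: add0r. Qed.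
Fact hom_addN : left_inverse hom_zero hom_opp hom_add.
Proof. by move=> f; apply: hom_ext => x /=; exact: addNr. Qed.

HB.instance Definition _ :=
  GRing.isZmodule.Build (hom U V) hom_addA hom_addC hom_add0 hom_addN.

End Hom.

HB.mixin Record Lmodule_isBimodule (R S : pzRingType) C
    of GRing.Lmodule R C := {
  rscale : C -> S -> C;
  rscalerA : forall c s t, rscale (rscale c s) t = rscale c (s * t);
  rscaler1 : forall c, rscale c 1 = c;
  rscalerDl : forall s, {morph rscale^~ s : c d / c + d};
  rscalerDr : forall c, {morph rscale c : s t / s + t};
  scale_rscale : forall (r : R) c s, r *: rscale c s = rscale (r *: c) s
}.

#[short(type="bimodType")]
HB.structure Definition Bimodule (R S : pzRingType) :=
  {C of Lmodule_isBimodule R S C & GRing.Lmodule R C}.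

(* The underlying right S-module of an (R,S)-bimodule. *)
Definition rmod (R S : pzRingType) (C : bimodType R S) : Type := C.

Section RightModule.
Context (R S : pzRingType) (C : bimodType R S).

HB.instance Definition _ := GRing.Zmodule.on (rmod C).

Definition rmod_scale (s : S^c) (c : rmod C) : rmod C := rscale (c : C) s.

Fact rmod_scaleA (s t : S^c) c :
  rmod_scale s (rmod_scale t c) = rmod_scale (s * t) c.
Proof. exact: rscalerA. Qed.
Fact rmod_scale1 : left_id 1 rmod_scale.
Proof. exact: rscaler1. Qed.
Fact rmod_scaleDr : right_distributive rmod_scale +%R.
Proof. by move=> s c d; apply: (@rscalerDl R S C). Qed.
Fact rmod_scaleDl c : {morph rmod_scale^~ c : s t / s + t}.
Proof. by move=> s t; apply: (@rscalerDr R S C). Qed.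

HB.instance Definition _ := GRing.Zmodule_isLmodule.Build S^c (rmod C)
  rmod_scaleA rmod_scale1 rmod_scaleDr rmod_scaleDl.

Definition lmul (r : R) (c : rmod C) : rmod C := r *: (c : C).
Definition rmul (s : S) (c : C) : C := rscale c s.

Fact lmul_is_linear r : linear (lmul r).
Proof.
by move=> s c d; rewrite /lmul scalerDr; congr (_ + _); exact: scale_rscale.
Qed.
HB.instance Definition _ r :=
  GRing.isLinear.Build S^c (rmod C) (rmod C) *:%R (lmul r) (lmul_is_linear r).

Fact rmul_is_linear s : linear (rmul s).
Proof. by move=> r c d; rewrite /rmul rscalerDl scale_rscale. Qed.
HB.instance Definition _ s :=
  GRing.isLinear.Build R C C *:%R (rmul s) (rmul_is_linear s).

Definition homothety_l (r : R) : hom (rmod C) (rmod C) :=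
  (lmul r) : {linear rmod C -> rmod C}.
Definition homothety_r (s : S) : hom C C := (rmul s) : {linear C -> C}.

End RightModule.

(* The left S-module Hom_R(C, M), with (s f)(c) = f(c s) *)

Section HomBimodule.
Context (R S : pzRingType) (C : bimodType R S) (M : lmodType R).

Definition hom_scale (s : S) (f : hom C M) : hom C M :=
  ((f : C -> M) \o rmul s) : {linear C -> M}.

Fact hom_scaleA s t f : hom_scale s (hom_scale t f) = hom_scale (s * t) f.
Proof. by apply: hom_ext => c /=; rewrite /rmul rscalerA. Qed.
Fact hom_scale1 : left_id 1 hom_scale.
Proof. by move=> f; apply: hom_ext => c /=; rewrite /rmul rscaler1. Qed.
Fact hom_scaleDr : right_distributive hom_scale +%R.
Proof. by move=> s f g; apply: hom_ext. Qed.
Fact hom_scaleDl f : {morph hom_scale^~ f : s t / s + t}.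
Proof.
by move=> s t; apply: hom_ext => c /=; rewrite /rmul rscalerDr; exact: raddfD.
Qed.

HB.instance Definition _ := GRing.Zmodule_isLmodule.Build S (hom C M)
  hom_scaleA hom_scale1 hom_scaleDr hom_scaleDl.

End HomBimodule.

Section Tensor.
Context (S : pzRingType) (A : lmodType S^c) (N : lmodType S).

(* The list [(a1,n1); ...; (ak,nk)] stands for the sum of the ai (x) ni;
   [tens_rel] is the congruence on formal sums generated by the relations of
   the tensor product. Opposites need no formal symbol since
   - (a (x) n) = (- a) (x) n. *)
Inductive tens_rel : seq (A * N) -> seq (A * N) -> Prop :=
| tens_refl u : tens_rel u u
| tens_sym u v : tens_rel u v -> tens_rel v u
| tens_trans u v w : tens_rel u v -> tens_rel v w -> tens_rel u w
| tens_cat u u' v v' :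
    tens_rel u u' -> tens_rel v v' -> tens_rel (u ++ v) (u' ++ v')
| tens_comm u v : tens_rel (u ++ v) (v ++ u)
| tens_Dl a b n : tens_rel [:: (a + b, n)] [:: (a, n); (b, n)]
| tens_Dr a m n : tens_rel [:: (a, m + n)] [:: (a, m); (a, n)]
| tens_0l n : tens_rel [:: (0, n)] [::]
| tens_bal (s : S) a n :
    tens_rel [:: ((s : S^c) *: a, n)] [:: (a, s *: n)].

Definition tens_relb (u v : seq (A * N)) : bool := `[< tens_rel u v >].

Fact tens_relb_refl : reflexive tens_relb.
Proof. by move=> u; apply/asboolP; exact: tens_refl. Qed.
Fact tens_relb_sym : symmetric tens_relb.
Proof. by move=> u v; apply/asboolP/asboolP; exact: tens_sym. Qed.
Fact tens_relb_trans : transitive tens_relb.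
Proof.
by move=> v u w /asboolP uv /asboolP vw; apply/asboolP; exact: tens_trans vw.
Qed.

Canonical tens_equiv :=
  EquivRel tens_relb tens_relb_refl tens_relb_sym tens_relb_trans.

Definition tensor : Type := {eq_quot tens_equiv}.
HB.instance Definition _ := Choice.on tensor.
HB.instance Definition _ := EqQuotient.on tensor.

Definition tens_class (u : seq (A * N)) : tensor := \pi_tensor u.

Fact tens_classP u v : tens_rel u v <-> tens_class u = tens_class v.
Proof. by split=> [|/eqmodP/asboolP//] uv; apply/eqmodP/asboolP. Qed.

Fact tens_repr u : tens_rel (repr (tens_class u)) u.
Proof. by apply/tens_classP; rewrite /tens_class reprK. Qed.

Definition tens (a : A) (n : N) : tensor := tens_class [:: (a, n)].

Definition tensor_zero : tensor := tens_class [::].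
Definition tensor_add (x y : tensor) : tensor := tens_class (repr x ++ repr y).
Definition tensor_opp (x : tensor) : tensor :=
  tens_class [seq (- p.1, p.2) | p <- repr x].

Fact tens_class_cat u v :
  tensor_add (tens_class u) (tens_class v) = tens_class (u ++ v).
Proof. by apply/tens_classP/tens_cat; exact: tens_repr. Qed.

Fact tensor_addA : associative tensor_add.
Proof.
move=> x y z; rewrite -[x]reprK -[y]reprK -[z]reprK -!/(tens_class _).
by rewrite !tens_class_cat catA.
Qed.
Fact tensor_addC : commutative tensor_add.
Proof. by move=> x y; apply/tens_classP; exact: tens_comm. Qed.
Fact tensor_add0 : left_id tensor_zero tensor_add.
Proof. by move=> x; rewrite -[x]reprK -!/(tens_class _) tens_class_cat. Qed.
Fact tensor_addN : left_inverse tensor_zero tensor_opp tensor_add.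
Proof.
move=> x; rewrite /tensor_opp -[in X in tensor_add _ X](reprK x).
rewrite -/(tens_class _) tens_class_cat; apply/tens_classP.
elim: (repr x) => [|[a n] u IH] /=; first exact: tens_refl.
apply: tens_trans (_ : tens_rel ([:: (- a, n)] ++ [:: (a, n)] ++
  ([seq (- p.1, p.2) | p <- u] ++ u)) _).
  rewrite -cat1s; apply: tens_cat; first exact: tens_refl.
  rewrite -cat1s !catA; apply: tens_cat; last exact: tens_refl.
  exact: tens_comm.
apply: tens_trans (_ : tens_rel ([::] ++ [::]) _); last exact: tens_refl.
rewrite catA; apply: tens_cat => //.
apply: tens_trans (tens_0l n); rewrite -(addNr a); apply: tens_sym.
exact: tens_Dl.
Qed.

HB.instance Definition _ := GRing.isZmodule.Build tensor
  tensor_addA tensor_addC tensor_add0 tensor_addN.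

Lemma tensDl a b n : tens (a + b) n = tens a n + tens b n.
Proof. by rewrite [RHS]tens_class_cat; apply/tens_classP; exact: tens_Dl. Qed.
Lemma tensDr a m n : tens a (m + n) = tens a m + tens a n.
Proof. by rewrite [RHS]tens_class_cat; apply/tens_classP; exact: tens_Dr. Qed.
Lemma tens_balanced (s : S) a n : tens ((s : S^c) *: a) n = tens a (s *: n).
Proof. by apply/tens_classP; exact: tens_bal. Qed.

Lemma tens_ind (P : tensor -> Prop) :
  P 0 -> (forall a n x, P x -> P (tens a n + x)) -> forall x, P x.
Proof.
move=> P0 PD x; rewrite -[x]reprK -/(tens_class _).
elim: (repr x) => [|[a n] u IH] //.
by rewrite -cat1s -tens_class_cat; exact: PD.
Qed.

(* The additive map induced by f; meaningful when f is balanced. *)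
Definition tens_lift (V : zmodType) (f : A -> N -> V) (x : tensor) : V :=
  \sum_(p <- repr x) f p.1 p.2.

Definition balanced (V : zmodType) (f : A -> N -> V) :=
  [/\ forall n, {morph f^~ n : a b / a + b},
      forall a, {morph f a : m n / m + n} &
      forall (s : S) a n, f ((s : S^c) *: a) n = f a (s *: n)].

Section Universal.
Context (V : zmodType) (f : A -> N -> V) (bal_f : balanced f).

Lemma tens_rel_sum u v : tens_rel u v ->
  \sum_(p <- u) f p.1 p.2 = \sum_(p <- v) f p.1 p.2.
Proof.
have [fDl fDr fB] := bal_f.
elim=> {u v} // [u v w _ -> _ ->|u u' v v' _ IHu _ IHv|u v|a b n|a m n|n|s a n] //.
- by rewrite !big_cat /= IHu IHv.
- by rewrite !big_cat /= addrC.
- by rewrite !big_cons !big_nil !addr0 /= fDl.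
- by rewrite !big_cons !big_nil !addr0 /= fDr.
- rewrite big_cons !big_nil addr0 /=.
  by apply: (addrI (f 0 n)); rewrite addr0 -fDl addr0.
- by rewrite !big_cons !big_nil !addr0 /= fB.
Qed.

Lemma tens_lift_class u :
  tens_lift f (tens_class u) = \sum_(p <- u) f p.1 p.2.
Proof. by apply: tens_rel_sum; exact: tens_repr. Qed.

Lemma tens_liftE a n : tens_lift f (tens a n) = f a n.
Proof. by rewrite tens_lift_class big_cons big_nil addr0. Qed.

Lemma tens_liftD : {morph tens_lift f : x y / x + y}.
Proof. by move=> x y; rewrite [x + y]/(tensor_add _ _) tens_lift_class big_cat. Qed.

Lemma tens_lift_unique (g : tensor -> V) :
  {morph g : x y / x + y} -> (forall a n, g (tens a n) = f a n) ->
  forall x, g x = tens_lift f x.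
Proof.
move=> gD gE; elim/tens_ind => [|a n x IH].
  rewrite [RHS]tens_lift_class big_nil.
  by apply: (addrI (g 0)); rewrite addr0 -gD addr0.
by rewrite gD tens_liftD IH gE tens_liftE.
Qed.

End Universal.

End Tensor.

Section TensorMap.
Context (S : pzRingType) (A B : lmodType S^c) (N : lmodType S).
Context (f : {linear A -> B}).

Definition tens_map : tensor A N -> tensor B N :=
  tens_lift (fun a n => tens (f a) n).

Fact tens_map_balanced : balanced (fun a (n : N) => tens (f a) n).
Proof.
split=> [n a b|a m n|s a n]; first by rewrite raddfD tensDl.
  exact: tensDr.
by rewrite linearZ /= tens_balanced.
Qed.

Lemma tens_mapE a n : tens_map (tens a n) = tens (f a) n.
Proof. exact: (tens_liftE tens_map_balanced). Qed.

End TensorMap.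

(* The left R-module structure of C (x)_S N, with r (c (x) n) = (r c) (x) n *)

Section TensorBimodule.
Context (R S : pzRingType) (C : bimodType R S) (N : lmodType S).

Definition tens_scale (r : R) : tensor (rmod C) N -> tensor (rmod C) N :=
  tens_map (@lmul R S C r : {linear rmod C -> rmod C}).

Fact tens_scaleE r c n : tens_scale r (tens c n) = tens (lmul r c) n.
Proof. exact: tens_mapE. Qed.
Fact tens_scaleDr : right_distributive tens_scale +%R.
Proof. by move=> r x y; exact: (tens_liftD (tens_map_balanced N (@lmul R S C r))). Qed.
Fact tens_scale0 r : tens_scale r 0 = 0.
Proof. by apply: (addrI (tens_scale r 0)); rewrite -tens_scaleDr !addr0. Qed.
Fact tens_scaleA r s x : tens_scale r (tens_scale s x) = tens_scale (r * s) x.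
Proof.
elim/tens_ind: x => [|c n x IH]; first by rewrite !tens_scale0.
rewrite !tens_scaleDr IH !tens_scaleE; congr (tens _ n + _).
exact: (@scalerA R C).
Qed.
Fact tens_scale1 : left_id 1 tens_scale.
Proof.
elim/tens_ind => [|c n x IH]; first by rewrite tens_scale0.
rewrite tens_scaleDr IH tens_scaleE; congr (tens _ n + _).
exact: (@scale1r R C).
Qed.
Fact tens_scaleDl x : {morph tens_scale^~ x : r s / r + s}.
Proof.
move=> r s; elim/tens_ind: x => [|c n x IH]; first by rewrite !tens_scale0 addr0.
rewrite !tens_scaleDr IH !tens_scaleE addrACA; congr (_ + _).
rewrite -tensDl; congr (tens _ n); exact: (@scalerDl R C).
Qed.

HB.instance Definition _ := GRing.Zmodule_isLmodule.Build R (tensor (rmod C) N)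
  tens_scaleA tens_scale1 tens_scaleDr tens_scaleDl.

End TensorBimodule.

Section Resolutions.
Context (R : pzRingType).
Implicit Types M N P : lmodType R.

Definition projective P : Prop :=
  forall (U V : lmodType R) (g : {linear U -> V}) (f : {linear P -> V}),
    (forall v, exists u, g u = v) ->
    exists h : {linear P -> U}, forall x, g (h x) = f x.

Definition finitely_generated M : Prop :=
  exists (n : nat) (e : 'I_n -> M),
    forall x, exists a : 'I_n -> R, x = \sum_(i < n) a i *: e i.

Record proj_resolution M := ProjResolution {
  res_obj :> nat -> lmodType R;
  res_diff : forall n, {linear res_obj n.+1 -> res_obj n};
  res_aug : {linear res_obj 0 -> M};
  res_projective : forall n, projective (res_obj n);
  res_aug_surj : forall m, exists x, res_aug x = m;
  res_exact0 : forall x, res_aug x = 0 <-> exists y, res_diff 0 y = x;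
  res_exactS : forall n x,
    res_diff n x = 0 <-> exists y, res_diff n.+1 y = x
}.

End Resolutions.

Section FreeModule.
Context (R : pzRingType) (X : choiceType).

Definition fcoef (u : seq (R * X)) : X -> R^o :=
  fun x => \sum_(p <- u | p.2 == x) p.1.

Definition free_pred : {pred X -> R^o} := fun f => `[< exists u, f = fcoef u >].

Fact free_pred_closed : submod_closed free_pred.
Proof.
split=> [|a f g /asboolP[u ->] /asboolP[v ->]]; apply/asboolP.
  by exists [::]; apply: funext => x; rewrite /fcoef big_nil.
exists ([seq (a * p.1, p.2) | p <- u] ++ v); apply: funext => x.
by rewrite /fcoef big_cat big_map /= -mulr_sumr.
Qed.
HB.instance Definition _ :=
  GRing.isSubmodClosed.Build R (X -> R^o) free_pred free_pred_closed.

Record free_mod := FreeMod {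
  free_val : X -> R^o;
  free_valP : free_val \in free_pred
}.
HB.instance Definition _ := [isSub for free_val].
HB.instance Definition _ := [Choice of free_mod by <:].
HB.instance Definition _ := [SubChoice_isSubLmodule of free_mod by <:].


Fact fcoef_in u : fcoef u \in free_pred.
Proof. by apply/asboolP; exists u. Qed.
Definition free_of u : free_mod := FreeMod (fcoef_in u).

Definition free_repr (f : free_mod) : seq (R * X) :=
  projT1 (cid (asboolW (free_valP f))).
Fact free_reprK f : free_of (free_repr f) = f.
Proof.
by apply: val_inj; rewrite /free_repr /=; case: cid => u fE.
Qed.

Fact free_of_lin a u v :
  a *: free_of u + free_of v = free_of ([seq (a * p.1, p.2) | p <- u] ++ v).
Proof.
apply: val_inj; apply: funext => x /=.
by rewrite /fcoef big_cat big_map /= -mulr_sumr.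
Qed.

Section Lift.
Context (M : lmodType R) (phi : X -> M).

Definition free_lift (f : free_mod) : M :=
  \sum_(p <- free_repr f) p.1 *: phi p.2.

Fact fcoef_sum (s u : seq _) : uniq s -> {subset map snd u <= s} ->
  \sum_(p <- u) p.1 *: phi p.2 = \sum_(x <- s) (fcoef u x : R) *: phi x.
Proof.
move=> s_uniq us; under [RHS]eq_bigr do rewrite /fcoef scaler_suml.
rewrite (exchange_big_dep predT) //= big_seq [RHS]big_seq; apply: eq_bigr => p pu.
rewrite (big_rem p.2) /=; last by rewrite us // map_f.
rewrite eqxx big_seq_cond big1 ?addr0 // => x /andP[+ /eqP xE].
by rewrite -xE mem_rem_uniq // inE eqxx.
Qed.

Lemma free_lift_of u : free_lift (free_of u) = \sum_(p <- u) p.1 *: phi p.2.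
Proof.
rewrite /free_lift; set v := free_repr _.
have uv : fcoef v = fcoef u by rewrite -[RHS](congr1 val (free_reprK (free_of u))).
pose s := undup (map snd u ++ map snd v).
rewrite !(@fcoef_sum s) ?undup_uniq ?uv // => x xin.
  by rewrite mem_undup mem_cat xin.
by rewrite mem_undup mem_cat xin orbT.
Qed.

Fact free_lift_linear : linear free_lift.
Proof.
move=> a f g; rewrite -(free_reprK f) -(free_reprK g) free_of_lin.
rewrite !free_lift_of big_cat big_map /= scaler_sumr; congr (_ + _).
by apply: eq_bigr => p _; rewrite scalerA.
Qed.
HB.instance Definition _ :=
  GRing.isLinear.Build R free_mod M *:%R free_lift free_lift_linear.

End Lift.

Definition free_gen (x : X) : free_mod := free_of [:: (1, x)].

Lemma free_lift_gen (M : lmodType R) (phi : X -> M) x :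
  free_lift phi (free_gen x) = phi x.
Proof. by rewrite free_lift_of big_cons big_nil addr0 scale1r. Qed.

Lemma free_lift_unique (M : lmodType R) (h : {linear free_mod -> M}) f :
  h f = free_lift (h \o free_gen) f.
Proof.
rewrite -(free_reprK f) free_lift_of.
elim: (free_repr f) => [|[a x] u IH].
  rewrite big_nil -[RHS](linear0 h); congr (h _); apply: val_inj => /=.
  by apply: funext => x; rewrite /fcoef big_nil.
by rewrite big_cons -IH /= -linearP free_of_lin /= mulr1.
Qed.

Lemma free_projective : projective free_mod.
Proof.
move=> U V g f g_surj; have /choice[w wE] x := g_surj (f (free_gen x)).
exists (free_lift w : {linear _ -> _}) => x.
rewrite [RHS]free_lift_unique -[LHS]/((g \o free_lift w) x) free_lift_unique.
by congr (free_lift _ x); apply: funext => y /=; rewrite free_lift_gen.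
Qed.

End FreeModule.

Section Kernel.
Context (R : pzRingType) (U V : lmodType R) (f : {linear U -> V}).

Definition kerm_pred : {pred U} := fun x => f x == 0.
Fact kerm_pred_closed : submod_closed kerm_pred.
Proof.
split=> [|a x y /eqP fx /eqP fy]; apply/eqP; first exact: linear0.
by rewrite linearP fx fy scaler0 addr0.
Qed.
HB.instance Definition _ :=
  GRing.isSubmodClosed.Build R U kerm_pred kerm_pred_closed.

Record kerm := Kerm {kerm_val : U; kerm_valP : kerm_val \in kerm_pred}.
HB.instance Definition _ := [isSub for kerm_val].
HB.instance Definition _ := [Choice of kerm by <:].
HB.instance Definition _ := [SubChoice_isSubLmodule of kerm by <:].

End Kernel.

Section Existence.
Context (R : pzRingType) (M : lmodType R).

Fixpoint syzygy n : lmodType R :=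
  match n with
  | 0 => M
  | m.+1 => kerm (free_lift (@id (syzygy m)))
  end.

Definition syz_cover n : {linear free_mod R (syzygy n) -> syzygy n} :=
  free_lift (@id (syzygy n)).
Definition syz_incl n : {linear syzygy n.+1 -> free_mod R (syzygy n)} :=
  (val : kerm _ -> _).

Fact syz_cover_surj n x : exists y, syz_cover n y = x.
Proof. by exists (free_gen R x); exact: free_lift_gen. Qed.

Fact syz_incl_inj n : injective (syz_incl n).
Proof. exact: val_inj. Qed.

Fact syz_exact n x : syz_cover n x = 0 <-> exists y, syz_incl n y = x.
Proof.
split=> [/eqP xK|[y <-]]; last by apply/eqP; exact: (kerm_valP y).
by exists (Kerm xK).
Qed.

Fact syz_exactd n x :
  syz_cover n x = 0 <-> exists y, (syz_incl n \o syz_cover n.+1) y = x.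
Proof.
rewrite syz_exact; split=> [[y <-]|[y <-]]; last by exists (syz_cover n.+1 y).
by have [z <-] := syz_cover_surj y; exists z.
Qed.

Lemma proj_resolution_exists : inhabited (proj_resolution M).
Proof.
unshelve refine (inhabits (@ProjResolution R M (fun n => free_mod R (syzygy n))
  (fun n => (syz_incl n \o syz_cover n.+1)) (syz_cover 0) _ _ _ _)).
- by move=> n; exact: free_projective.
- exact: (@syz_cover_surj 0).
- exact: (@syz_exactd 0).
- move=> n x; rewrite -syz_exactd /=; split=> [|->]; last exact: (linear0 (syz_incl n)).
  by rewrite -(linear0 (syz_incl n)) => /syz_incl_inj.
Qed.

End Existence.

Section Ext.
Context (R : pzRingType).
Implicit Types M N : lmodType R.

Definition ext_cocycle M N (P : proj_resolution M) i
    (f : {linear P i -> N}) : Prop :=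
  forall x, f (res_diff P i x) = 0.

Definition ext_coboundary M N (P : proj_resolution M) i :
    {linear P i -> N} -> Prop :=
  match i with
  | 0 => fun f => forall x, f x = 0
  | j.+1 => fun f =>
      exists g : {linear P j -> N}, forall x, f x = g (res_diff P j x)
  end.

(* Ext^i_R(M, N) = 0, computed from any projective resolution of M; these exist
   by [proj_resolution_exists]. *)
Definition ext_zero M N i : Prop :=
  forall (P : proj_resolution M) (f : {linear P i -> N}),
    ext_cocycle f -> ext_coboundary f.

End Ext.

Section Tor.
Context (S : pzRingType) (A : lmodType S^c) (N : lmodType S).
Implicit Type P : proj_resolution A.

Definition tor_cycle P i : tensor (P i) N -> Prop :=
  match i with
  | 0 => fun _ => True
  | j.+1 => fun x => tens_map (res_diff P j) x = 0
  end.

Definition tor_boundary P i (x : tensor (P i) N) : Prop :=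
  exists y, tens_map (res_diff P i) y = x.

(* Tor_i^S(A, N) = 0, computed from any projective resolution of A. *)
Definition tor_zero i : Prop :=
  forall P (x : tensor (P i) N), tor_cycle x -> tor_boundary x.

End Tor.

Definition has_fg_proj_resolution (R : pzRingType) (M : lmodType R) : Prop :=
  exists P : proj_resolution M, forall n, finitely_generated (P n).

Record semidualizing (R S : pzRingType) (C : bimodType R S) : Prop := {
  semidualizing_a1 : has_fg_proj_resolution C;
  semidualizing_a2 : has_fg_proj_resolution (rmod C);
  semidualizing_b1 : bijective (homothety_l C);
  semidualizing_b2 : bijective (homothety_r C);
  semidualizing_c1 : forall i, (1 <= i)%N -> ext_zero C C i;
  semidualizing_c2 : forall i, (1 <= i)%N -> ext_zero (rmod C) (rmod C) i
}.

Section Classes.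
Context (R S : pzRingType) (C : bimodType R S).

Section Mu.
Context (N : lmodType S).

Definition mu_fun (x : N) (c : C) : tensor (rmod C) N := tens (c : rmod C) x.

Fact mu_fun_is_linear x : linear (mu_fun x).
Proof.
move=> r c d; rewrite /mu_fun; rewrite [LHS]tensDl; congr (_ + _).
by rewrite [RHS]tens_scaleE.
Qed.
HB.instance Definition _ x :=
  GRing.isLinear.Build R C (tensor (rmod C) N) *:%R (mu_fun x)
    (mu_fun_is_linear x).

Definition mu (x : N) : hom C (tensor (rmod C) N) :=
  (mu_fun x) : {linear C -> tensor (rmod C) N}.

Fact mu_is_linear : linear mu.
Proof.
move=> s x y; apply: hom_ext => c /=; rewrite /mu_fun tensDr; congr (_ + _).
by rewrite -tens_balanced.
Qed.

End Mu.

Section Theta.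
Context (M : lmodType R).

Definition ev (c : rmod C) (f : hom C M) : M := f (c : C).

Definition theta : tensor (rmod C) (hom C M) -> M := tens_lift ev.

Fact ev_balanced : balanced ev.
Proof. by split=> [f c d|c f g|s c f] //; rewrite /ev; exact: raddfD. Qed.

Lemma thetaE c f : theta (tens c f) = f c.
Proof. exact: (tens_liftE ev_balanced). Qed.

Fact thetaD : {morph theta : x y / x + y}.
Proof. exact: (tens_liftD ev_balanced). Qed.

Fact theta_is_linear : linear theta.
Proof.
have theta0 : theta 0 = 0.
  by apply: (addrI (theta 0)); rewrite -thetaD !addr0.
move=> r x y; rewrite thetaD; congr (_ + _).
elim/tens_ind: x => [|c f x IH]; first by rewrite scaler0 theta0 scaler0.
rewrite scalerDr !thetaD IH scalerDr; congr (_ + _).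
rewrite [_ *: _]tens_scaleE !thetaE /lmul.
exact: (linearZZ (f : {linear C -> M})).
Qed.

End Theta.

Definition auslander_class (N : lmodType S) : Prop :=
  [/\ forall i, (1 <= i)%N -> tor_zero (rmod C) N i,
      forall i, (1 <= i)%N -> ext_zero C (tensor (rmod C) N) i &
      bijective (@mu N)].

Definition bass_class (M : lmodType R) : Prop :=
  [/\ forall i, (1 <= i)%N -> ext_zero C M i,
      forall i, (1 <= i)%N -> tor_zero (rmod C) (hom C M) i &
      bijective (@theta M)].

End Classes.

Section Envelopes.
Context (T : pzRingType) (X : lmodType T -> Prop).

Definition preenvelope (Y Z : lmodType T) (f : {linear Y -> Z}) : Prop :=
  X Z /\ forall (Z' : lmodType T) (g : {linear Y -> Z'}), X Z' ->
    exists h : {linear Z -> Z'}, forall y, h (f y) = g y.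

Definition left_minimal (Y Z : lmodType T) (f : {linear Y -> Z}) : Prop :=
  forall h : {linear Z -> Z}, (forall y, f y = h (f y)) -> bijective h.

Definition envelope (Y Z : lmodType T) (f : {linear Y -> Z}) : Prop :=
  preenvelope f /\ left_minimal f.

Definition enveloping : Prop :=
  forall Y : lmodType T, exists (Z : lmodType T) (f : {linear Y -> Z}),
    envelope f.

End Envelopes.

(* Main.v *)
From HB Require Import structures.
From mathcomp Require Import all_boot all_algebra.
Require Import Defs.

(* The functor C (x)_S - is left adjoint to Hom_R(C, -), and by the triangle
   identities the two restrict to inverse equivalences between the Auslander and
   the Bass class. If g : C (x) N -> B is a Bass envelope, then its adjunct
   N -> Hom_R(C, B) is an Auslander envelope: a map N -> A with A in the
   Auslander class is the adjunct of a map C (x) N -> C (x) A, which factors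
   through g, and endomorphisms of Hom_R(C, B) come from endomorphisms of B. *)

Set Implicit Arguments.
Unset Strict Implicit.
Unset Printing Implicit Defensive.

Import GRing.Theory.
Local Open Scope ring_scope.

(** Both classes assert only bijectivity of [mu] or [theta]; applying functors to the inverse
    requires it as a linear map. *)
Lemma linear_inverse (R : pzRingType) (U V : lmodType R) (f : {linear U -> V}) :
  bijective f -> exists2 g : {linear V -> U}, cancel f g & cancel g f.
Proof.
case=> g fK gK.
have g_lin : linear g.
  by move=> a x y; apply: (can_inj fK); rewrite linearP !gK.
pose gL := GRing.isLinear.Build R V U *:%R g g_lin.
by exists (HB.pack_for {linear V -> U} g gL).
Qed.

Lemma morph_add0 (U V : zmodType) (f : U -> V) :
  {morph f : x y / x + y} -> f 0 = 0.
Proof. by move=> fD; apply: (addrI (f 0)); rewrite -fD !addr0. Qed.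

Section TensorMapRight.
Context (S : pzRingType) (A : lmodType S^c).
Implicit Types M N : lmodType S.

Definition tens_mapr M N (f : {linear M -> N}) : tensor A M -> tensor A N :=
  tens_lift (fun a m => tens a (f m)).

Fact tens_mapr_balanced M N (f : {linear M -> N}) :
  balanced (fun (a : A) m => tens a (f m)).
Proof.
split=> [m a b|a m n|s a m]; first exact: tensDl.
  by rewrite raddfD tensDr.
by rewrite linearZ /= tens_balanced.
Qed.

Lemma tens_maprE M N (f : {linear M -> N}) a m :
  tens_mapr f (tens a m) = tens a (f m).
Proof. exact: (tens_liftE (tens_mapr_balanced f)). Qed.

Lemma tens_maprD M N (f : {linear M -> N}) :
  {morph tens_mapr f : x y / x + y}.
Proof. exact: (tens_liftD (tens_mapr_balanced f)). Qed.

Lemma tensor_add_ext M (V : zmodType) (f g : tensor A M -> V) :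
    {morph f : x y / x + y} -> {morph g : x y / x + y} ->
    (forall a m, f (tens a m) = g (tens a m)) -> f =1 g.
Proof.
move=> fD gD fg; elim/tens_ind => [|a m x IH]; last by rewrite fD gD fg IH.
by rewrite !morph_add0.
Qed.

Lemma tens_mapr_cancel M N (f : {linear M -> N}) (g : {linear N -> M}) :
  cancel f g -> cancel (tens_mapr f) (tens_mapr g).
Proof.
move=> fK; apply: tensor_add_ext => // [x y|a m]; first by rewrite !tens_maprD.
by rewrite !tens_maprE fK.
Qed.

End TensorMapRight.

Lemma tens_mapD (S : pzRingType) (A B : lmodType S^c) (N : lmodType S)
    (d : {linear A -> B}) : {morph @tens_map S A B N d : x y / x + y}.
Proof. exact: (tens_liftD (tens_map_balanced N d)). Qed.

(** Bifunctoriality of the tensor product: it makes [tens_mapr f] commute with the differentials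
    computing Tor, and with the action of R. *)
Lemma tens_map_maprC (S : pzRingType) (A B : lmodType S^c) (M N : lmodType S)
    (d : {linear A -> B}) (f : {linear M -> N}) (x : tensor A M) :
  tens_map d (tens_mapr f x) = tens_mapr f (tens_map d x).
Proof.
move: x; apply: tensor_add_ext => [x y|x y|a m].
- by rewrite tens_maprD tens_mapD.
- by rewrite tens_mapD tens_maprD.
by rewrite tens_maprE !tens_mapE tens_maprE.
Qed.

(** A cycle over N is pushed by [g] to M, where it bounds; [f] carries the bounding chain back. *)
Lemma tor_zero_retract (S : pzRingType) (A : lmodType S^c) (M N : lmodType S)
    (f : {linear M -> N}) (g : {linear N -> M}) i :
  cancel g f -> tor_zero A M i -> tor_zero A N i.
Proof.
move=> gK tM P x x_cycle.
have /tM[y yE] : tor_cycle (tens_mapr g x).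
  case: i x x_cycle {tM} => //= j x xE; rewrite tens_map_maprC xE.
  exact: (morph_add0 (tens_maprD g)).
exists (tens_mapr f y); rewrite tens_map_maprC yE.
exact: tens_mapr_cancel.
Qed.

Lemma ext_zero_retract (R : pzRingType) (L M N : lmodType R)
    (f : {linear M -> N}) (g : {linear N -> M}) i :
  cancel g f -> ext_zero L M i -> ext_zero L N i.
Proof.
move=> gK eM P u u_cocycle.
have /eM {eM} : ext_cocycle (g \o u) by move=> x /=; rewrite u_cocycle linear0.
case: i u {u_cocycle} => [|j] u /= => [u0 x|[v vE]].
  by rewrite -[LHS]gK u0 linear0.
by exists (f \o v) => x /=; rewrite -vE gK.
Qed.

Section HomPost.
Context (R S : pzRingType) (C : bimodType R S).

Definition hom_post (M N : lmodType R) (g : {linear M -> N}) (f : hom C M) :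
  hom C N := (g \o (f : {linear C -> M})) : {linear C -> N}.

Fact hom_post_is_linear (M N : lmodType R) (g : {linear M -> N}) :
  linear (hom_post g).
Proof.
by move=> s u v; apply: hom_ext => c /=; rewrite [LHS]raddfD.
Qed.
HB.instance Definition _ (M N : lmodType R) (g : {linear M -> N}) :=
  GRing.isLinear.Build S (hom C M) (hom C N) *:%R (hom_post g)
    (hom_post_is_linear g).

Lemma hom_post_bij (M N : lmodType R) (g : {linear M -> N}) :
  bijective g -> bijective (hom_post g).
Proof.
case/linear_inverse=> h gK hK.
by exists (hom_post h) => u; apply: hom_ext => c /=; rewrite ?gK ?hK.
Qed.

HB.instance Definition _ (N : lmodType S) :=
  GRing.isLinear.Build S N (hom C (tensor (rmod C) N)) *:%R (@mu R S C N)
    (@mu_is_linear R S C N).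

HB.instance Definition _ (M : lmodType R) :=
  GRing.isLinear.Build R (tensor (rmod C) (hom C M)) M *:%R (@theta R S C M)
    (@theta_is_linear R S C M).

Fact tens_mapr_is_linear (M N : lmodType S) (f : {linear M -> N}) :
  linear (@tens_mapr S (rmod C) M N f).
Proof.
(* Scaling by [r] is by definition [tens_map (lmul r)], so bifunctoriality applies. *)
by move=> r x y; rewrite tens_maprD [in LHS]/GRing.scale /= -tens_map_maprC.
Qed.
HB.instance Definition _ (M N : lmodType S) (f : {linear M -> N}) :=
  GRing.isLinear.Build R (tensor (rmod C) M) (tensor (rmod C) N) *:%R
    (@tens_mapr S (rmod C) M N f) (tens_mapr_is_linear f).

(** The Tor condition is shared verbatim; the Ext condition moves from M along the inverse of
    [theta]. By the triangle identity, [mu] is a right inverse of the bijection [hom_post theta]. *)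
Lemma hom_auslander (M : lmodType R) :
  bass_class C M -> auslander_class C (hom C M).
Proof.
case=> extM torM theta_bij; have [t thetaK tK] := linear_inverse theta_bij.
split=> // [i i_gt0|]; first exact: (ext_zero_retract thetaK (extM i i_gt0)).
have mu_theta : cancel (@mu R S C (hom C M)) (hom_post (@theta R S C M)).
  by move=> u; apply: hom_ext => c; exact: thetaE.
have post_inj := bij_inj (hom_post_bij theta_bij).
exact: Bijective mu_theta (inj_can_sym mu_theta post_inj).
Qed.

(** Dually, Ext is shared and Tor moves from N along [mu]. The other triangle identity makes [theta]
    a left inverse of the bijection [tens_mapr mu]. *)
Lemma tensor_bass (N : lmodType S) :
  auslander_class C N -> bass_class C (tensor (rmod C) N).
Proof.
case=> torN extN mu_bij; have [m muK mK] := linear_inverse mu_bij.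
split=> // [i i_gt0|]; first exact: (tor_zero_retract mK (torN i i_gt0)).
have theta_mu : cancel (@tens_mapr S (rmod C) N _ (@mu R S C N))
    (@theta R S C (tensor (rmod C) N)).
  apply: tensor_add_ext => // [x y|c n]; first by rewrite tens_maprD thetaD.
  by rewrite tens_maprE thetaE.
apply: (bij_can_bij _ theta_mu).
by exists (tens_mapr m); exact: tens_mapr_cancel.
Qed.

End HomPost.

Theorem theorem1p2 (R S : pzRingType) (C : bimodType R S)
    (hC : semidualizing C) :
  enveloping (bass_class C) -> enveloping (auslander_class C).
Proof.
move=> bass_env N.
have [B [g [[bassB g_pre] g_min]]] := bass_env (tensor (rmod C) N).
pose f : {linear N -> hom C B} := hom_post g \o @mu R S C N.
exists (hom C B), f; split.
  split=> [|A k ausA]; first exact: hom_auslander.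
  have [h hE] := g_pre _ (@tens_mapr S (rmod C) N A k) (tensor_bass ausA).
  have [_ _ /linear_inverse[m muK _]] := ausA.
  (* Since [h] extends [tens_mapr k] along [g], [hom_post h (f n)] is [mu (k n)], and [m] undoes
     [mu]. *)
  exists (m \o hom_post h) => n /=; rewrite -[RHS]muK; congr (m _).
  by apply: hom_ext => c; rewrite [LHS]hE; exact: tens_maprE.
move=> k fk.
have [_ _ /linear_inverse[t thetaK tK]] := bassB.
(* Conjugating [tens_mapr k] by [theta] gives the endomorphism of B that induces [k]. *)
pose h : {linear B -> B} := @theta R S C B \o (tens_mapr k \o t).
have hE : forall u : hom C B, hom_post h u = k u.
  move=> u; apply: hom_ext => c.
  apply: etrans (thetaE (c : rmod C) (k u)).
  rewrite -[tens _ (k u)](tens_maprE k) -[tens _ u]thetaK.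
  by congr (theta (tens_mapr k (t _))); rewrite [RHS]thetaE.
have h_bij : bijective h.
  (* On generators, [h] fixing [g] is the hypothesis [fk] evaluated at [c], with [k] replaced by
     [hom_post h]. *)
  apply: g_min; apply: tensor_add_ext => [x y|x y|c n]; rewrite ?raddfD //.
  exact: (congr1 (fun u : hom C B => u c) (etrans (fk n) (esym (hE _)))).
exact: eq_bij (hom_post_bij C h_bij) _ hE.
Qed.
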